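(* Let $f:(a,b)\to\mathbb R$ be a sufficiently differentiable function over an open interval $(a,b)$, and let $x_*\in(a,b)$. Suppose $k$ and $N$ are positive integers with matching parity, assuming $N-k\ge 1$. Then, for a given $N$-point, centered stencil, with fundamental stencil $\{a_n\}$ and stencil size $h>0$, there exists a unique set of coefficients $\{c_n\}$ such that $$D^k f(x_* ) := \sum_{n=-M}^M c_nf(x_*+a_nh)\quad (\text{odd } N)$$ or $$D^k f(x_* ) := \sum_{n=1}^M\Big[ c_{-n}f(x_*+a_{-n}h)+c_nf(x_*+a_nh)\Big]\quad (\text{even } N)$$ is a finite difference approximation of $f^{(k)}(x_* )$ with accuracy order exactly $N-k$, assuming $f^{(N)}(x_* )\neq 0$. In other words, $$\left| D^k f(x_* ) - f^{(k)}(x_* )\right| = \Theta(h^{N-k}).$$ Furthermore, $\{c_n\}$ must be symmetric if $k$ is even or skew-symmetric if $k$ is odd.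
   Context: A finite difference approximation of $f^{(k)}(x_* )$ is a linear combination of values of $f$ at the points of a stencil $\{x_n\}$, with coefficients $c_n$. The stencil points are assumed distinct, ordered (increasing in $n$) and contained in $(a,b)$, and are written $x_n=x_*+a_nh$, where $h>0$ is the stencil size and the real numbers $a_n$, independent of $h$, form the fundamental stencil. Write $N=2M+1$ if $N$ is odd and $N=2M$ if $N$ is even, with $M\in\mathbb N$. The stencil is indexed by $n=-M,\dots,M$ if $N$ is odd, and by the same range excluding $n=0$ if $N$ is even. It is centered if $a_{-n}=-a_n$ for all $n=1,\dots,M$ and, in the case $N$ is odd, $a_0=0$. The coefficients are symmetric if $c_{-n}=c_n$ for all $n=1,\dots,M$, and skew-symmetric if $c_{-n}=-c_n$ for all $n=1,\dots,M$. For real-valued functions $E,g$, $E(h)=\Theta(g(h))$ (as $h\to0^+$) means that there are constants $C_*,C^*>0$ with $C_*|g(h)|\le|E(h)|\le C^*|g(h)|$ for all sufficiently small $h>0$. The approximation has accuracy order exactly $r$ if its error is $\Theta(h^r)$.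
   Formalization: Coefficients may depend on h but not on f (accuracy is required for all f with f^(N)(x_* )≠0), and uniqueness is among families c_n=γ_n h^p with a common real exponent p; among arbitrary functions of h it fails, as adding h^N to one c_n keeps the exact order N-k. *)

(* Defs.v *)
From mathcomp Require Import all_boot all_order all_algebra.
From mathcomp Require Import all_classical all_reals all_analysis.

Set Implicit Arguments.
Unset Strict Implicit.
Unset Printing Implicit Defensive.

Import Order.TTheory GRing.Theory Num.Theory.
Import numFieldNormedType.Exports.

Local Open Scope classical_set_scope.
Local Open Scope ring_scope.

(* An N-point stencil, N = 2M + 1 or N = 2M with M = N./2, is indexed by the
   integers -M, ..., M, the index 0 being left out when N is even. Families
   (a_n), (c_n) are functions on int; their values outside the index range are
   junk and must never matter. *)
Definition stencil_index (N : nat) : {pred int} :=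
  [pred n : int | (`|n| <= N./2%:Z) && (odd N || (n != 0))].

(* Distinct and ordered points a_n. *)
Definition fundamental_stencil (R : realType) (N : nat) (an : int -> R) : Prop :=
  {in stencil_index N &, {homo an : m n / m < n}}.

Definition centered (R : realType) (N : nat) (an : int -> R) : Prop :=
  (forall n : nat, (1 <= n <= N./2)%N -> an (- n%:Z) = - an n%:Z) /\
  (odd N -> an 0 = 0).

Definition symmetric_coeffs (R : realType) (N : nat) (c : int -> R) : Prop :=
  forall n : nat, (1 <= n <= N./2)%N -> c (- n%:Z) = c n%:Z.

Definition skew_symmetric_coeffs (R : realType) (N : nat) (c : int -> R) : Prop :=
  forall n : nat, (1 <= n <= N./2)%N -> c (- n%:Z) = - c n%:Z.

(* In the odd case the summation index n = -M, ..., M is i - M for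
   i = 0, ..., 2M. *)
Definition finite_difference (R : realType) (N : nat) (an c : int -> R)
    (f : R -> R) (x h : R) : R :=
  let M := N./2 in
  let term (n : int) := c n * f (x + an n * h) in
  if odd N then \sum_(0 <= i < (2 * M).+1) term (i%:Z - M%:Z)
  else \sum_(1 <= n < M.+1) (term (- n%:Z) + term n%:Z).

Definition differentiable_n (R : realType) (N : nat) (a b : R) (f : R -> R) : Prop :=
  forall j : nat, (j < N)%N -> forall x : R, x \in `]a, b[ -> derivable (f^`(j))%classic x 1.

(* The coefficients c h n may depend on the stencil size h, but neither on the
   function f nor, since R-valued functions are total, on the values of f
   outside of ]a, b[: for small h all the points x + an n * h are in ]a, b[. *)
Definition accuracy_order (R : realType) (N k r : nat) (a b x : R)
    (an : int -> R) (c : R -> int -> R) : Prop :=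
  forall f : R -> R, differentiable_n N a b f -> (f^`(N))%classic x != 0 ->
    (fun h : R => finite_difference N an (c h) f x h - (f^`(k))%classic x)
      \is 'Theta_(0^'+) (fun h : R => h ^+ r).

(* The coefficients follow the stencil size h through a common power of h, as in
   f'(x) ~ (f(x + h) - f(x - h)) / (2 h). The exponent is not prescribed.
   Without such a law the coefficients could not be unique, as any term
   negligible before h ^+ (N - k), e.g. h ^+ N, could be added to them. *)
Definition power_law (R : realType) (N : nat) (c : R -> int -> R) : Prop :=
  exists (p : R) (gamma : int -> R),
    forall (h : R) (n : int), 0 < h -> n \in stencil_index N ->
      c h n = gamma n * h `^ p.

(* Main.v *)
(* The weights are k! [X^k] L_n, where L_n is the Lagrange basis of the a_n:
   by interpolation they are the unique solution of the moment equations
   sum_n w_n a_n^j = k! delta_(jk), j < N, and uniqueness under n |-> -n gives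
   the (skew-)symmetry. By Taylor's formula with Peano remainder the error of
   sum_n w_n h^(-k) f(x + a_n h) is S f^(N)(x) / N! h^(N-k) + o(h^(N-k)), with
   S = sum_n w_n a_n^N. Interpolating X^N - W, W = prod_n (X - a_n), gives
   S = - k! [X^k] W. For a centered stencil W is X^(0 or 1) prod (X^2 - a_n^2), so
   all its coefficients in degrees of the parity of N, up to N, alternate in sign
   and none vanishes. Conversely, testing an approximation on polynomials forces
   the exponent of h to be -k and the moment equations to hold. *)

Require Import Defs.
From mathcomp Require Import all_boot all_order all_algebra.
From mathcomp Require Import all_classical all_reals all_analysis.
From mathcomp Require Import ring lra zify.
Import Order.TTheory GRing.Theory Num.Theory.
Import numFieldNormedType.Exports.
Local Open Scope classical_set_scope.
Local Open Scope ring_scope.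

Set Implicit Arguments.
Unset Strict Implicit.
Unset Printing Implicit Defensive.

(** * Lagrange interpolation and the weights it defines *)

Definition lagrange {R : fieldType} {I : eqType} (s : seq I) (a : I -> R) (n : I)
  : {poly R} :=
  \prod_(m <- s | m != n) ((a n - a m)^-1 *: ('X - (a m)%:P)).

Lemma lagrange_sample (R : fieldType) (I : eqType) (s : seq I) (a : I -> R) m n :
  {in s &, injective a} -> m \in s -> n \in s ->
  (lagrange s a n).[a m] = (n == m)%:R.
Proof.
move=> ainj ms ns; rewrite /lagrange horner_prod; have [<-|nm] := eqVneq n m.
  rewrite big_seq_cond big1 // => i /andP[si ni].
  rewrite hornerZ !hornerE mulVf // subr_eq0.
  by apply: contra ni => /eqP /(ainj _ _ ns si) ->.
apply/eqP; rewrite prodf_seq_eq0; apply/hasP; exists m => //.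
by rewrite eq_sym nm hornerZ !hornerE subrr mulr0 eqxx.
Qed.

Lemma size_lagrange (R : fieldType) (I : eqType) (s : seq I) (a : I -> R) n :
  uniq s -> n \in s -> (size (lagrange s a n) <= size s)%N.
Proof.
move=> us ns; rewrite (perm_size (perm_to_rem ns)) /=.
rewrite /lagrange -big_filter -rem_filter //.
elim: (rem n s) => [|m t IH]; first by rewrite big_nil size_poly1.
rewrite big_cons -scalerAl; apply: leq_trans (size_scale_leq _ _) _.
by rewrite mulrC (leq_trans (size_polyMleq _ _))// size_XsubC addn2.
Qed.

(** The difference of the two sides has size at most [size s] and vanishes at [size s] distinct
    nodes. *)
Lemma lagrange_interpolation (R : fieldType) (I : eqType) (s : seq I) (a : I -> R)
    (p : {poly R}) :
  uniq s -> {in s &, injective a} -> (size p <= size s)%N ->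
  p = \sum_(n <- s) p.[a n] *: lagrange s a n.
Proof.
move=> us ainj sp; apply/eqP; rewrite -subr_eq0; apply/eqP.
apply: (@roots_geq_poly_eq0 _ _ (map a s)).
- apply/allP => _ /mapP[m ms ->]; rewrite rootE hornerD hornerN horner_sum.
  rewrite (bigD1_seq m) //= big_seq_cond big1 => [|i /andP[si im]].
    by rewrite hornerZ lagrange_sample // eqxx mulr1 addr0 subrr.
  by rewrite hornerZ lagrange_sample // (negPf im) mulr0.
- by rewrite map_inj_in_uniq.
- rewrite size_map (leq_trans (size_polyD _ _)) // geq_max sp size_polyN /=.
  rewrite big_seq; apply: (leq_trans (size_sum _ _ _)).
  apply/bigmax_leqP_seq => n ns _; apply: leq_trans (size_scale_leq _ _) _.
  exact: size_lagrange.
Qed.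

(** This is the [k]-th derivative at 0 of the basis polynomial, so weighting samples by it
    differentiates their interpolant [k] times at 0. *)
Definition fd_weight {R : fieldType} {I : eqType} (s : seq I) (a : I -> R)
  (k : nat) (n : I) : R := k`!%:R * (lagrange s a n)`_k.

Lemma fd_weight_exact (R : fieldType) (I : eqType) (s : seq I) (a : I -> R) k
    (p : {poly R}) :
  uniq s -> {in s &, injective a} -> (size p <= size s)%N ->
  \sum_(n <- s) fd_weight s a k n * p.[a n] = k`!%:R * p`_k.
Proof.
move=> us ainj sp; rewrite [in RHS](lagrange_interpolation us ainj sp).
rewrite coef_sum mulr_sumr; apply: eq_bigr => n _.
by rewrite coefZ /fd_weight -mulrA [X in _ * X]mulrC.
Qed.

Lemma fd_weight_moment (R : fieldType) (I : eqType) (s : seq I) (a : I -> R) k j :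
  uniq s -> {in s &, injective a} -> (j < size s)%N ->
  \sum_(n <- s) fd_weight s a k n * a n ^+ j = k`!%:R * (j == k)%:R.
Proof.
move=> us ainj js; have := @fd_weight_exact _ _ s a k 'X^j us ainj.
rewrite size_polyXn coefXn eq_sym => <- //.
by apply: eq_bigr => n _; rewrite hornerXn.
Qed.

(** Testing a weight family on the basis polynomial of [n] isolates its value at [n]; expanding that
    polynomial in monomials expresses the same value through moments of order below [size s], and
    these are prescribed. *)
Lemma fd_weight_unique (R : fieldType) (I : eqType) (s : seq I) (a : I -> R) k
    (g : I -> R) :
  uniq s -> {in s &, injective a} ->
  (forall j, (j < size s)%N ->
     \sum_(n <- s) g n * a n ^+ j = k`!%:R * (j == k)%:R) ->
  {in s, g =1 fd_weight s a k}.
Proof.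
move=> us ainj gm n ns; set L := lagrange s a n.
have sL : (size L <= size s)%N by exact: size_lagrange.
have E (w : I -> R) : \sum_(m <- s) w m * L.[a m] = w n.
  rewrite (bigD1_seq n) //= big_seq_cond big1 => [|i /andP[si im]].
    by rewrite lagrange_sample // eqxx mulr1 addr0.
  by rewrite lagrange_sample // eq_sym (negPf im) mulr0.
have F (w : I -> R) : \sum_(m <- s) w m * L.[a m] =
    \sum_(j < size s) L`_j * \sum_(m <- s) w m * a m ^+ j.
  under [in RHS]eq_bigr do rewrite mulr_sumr.
  rewrite exchange_big /=; apply: eq_bigr => m _.
  rewrite (horner_coef_wide _ sL) mulr_sumr; apply: eq_bigr => j _.
  by rewrite mulrCA.
rewrite -E F -[RHS]E F; apply: eq_bigr => j _.
by rewrite gm // fd_weight_moment.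
Qed.

(** Subtracting the monic node polynomial from ['X^(size s)] lowers the degree without changing the
    values at the nodes, so exactness applies to the difference; as [k < size s], the monomial has
    no coefficient at [k]. *)
Lemma fd_weight_leading_moment (R : fieldType) (I : eqType) (s : seq I) (a : I -> R) k :
  uniq s -> {in s &, injective a} -> (k < size s)%N ->
  \sum_(n <- s) fd_weight s a k n * a n ^+ size s =
  - (k`!%:R * (\prod_(n <- s) ('X - (a n)%:P))`_k).
Proof.
move=> us ainj ks; set w := \prod_(n <- s) _.
have sw : size w = (size s).+1.
  by rewrite /w size_prod_XsubC.
have wm : w \is monic by exact: monic_prod_XsubC.
have sp : (size ('X^(size s) - w)%R <= size s)%N.
  apply/leq_sizeP => j; rewrite leq_eqVlt coefB coefXn => /orP[/eqP <-|sj].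
    by rewrite eqxx -(monicP wm) lead_coefE sw subrr.
  by rewrite (gtn_eqF sj) sub0r nth_default ?oppr0 // sw.
have := fd_weight_exact k us ainj sp.
rewrite coefB coefXn (ltn_eqF ks) sub0r mulrN => <-.
rewrite big_seq [RHS]big_seq; apply: eq_bigr => n ns.
rewrite !hornerE horner_prod [\prod_(_ <- _) _](_ : _ = 0) ?subr0 //.
by apply/eqP; rewrite prodf_seq_eq0; apply/hasP; exists n => //=; rewrite !hornerE subrr.
Qed.

(** * Alternating signs in products of quadratic factors *)

(** A new factor ['X^2 - b] turns the coefficients of a product [Q] into [Q_(2j) - b Q_(2j+2)]; as
    consecutive ones alternate in sign and [b > 0], the two terms never cancel. The vanishing
    alternative covers the top degree in the induction. *)
Lemma prod_X2subC_sign (R : realDomainType) (I : eqType) (r : seq I) (b : I -> R) j :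
  {in r, forall i, 0 < b i} ->
  (if (j <= size r)%N then 0 < (-1) ^+ (size r + j) * (\prod_(i <- r) ('X^2 - (b i)%:P))`_j.*2
   else (\prod_(i <- r) ('X^2 - (b i)%:P))`_j.*2 == 0).
Proof.
elim: r j => [|i r IH] j b0.
  rewrite big_nil coef1; case: j => [|j] /=; first by rewrite mulr1 expr0 ltr01.
  by rewrite eqxx.
have bi : 0 < b i by apply: b0; rewrite inE eqxx.
have {}b0 : {in r, forall m, 0 < b m}.
  by move=> m mr; apply: b0; rewrite inE mr orbT.
have {}IH m := IH m b0.
rewrite big_cons mulrBl coefB coefCM coefXnM /=.
set Q := \prod_(_ <- _) _ in IH *.
case: j => [|j].
  rewrite /= sub0r addn0 exprS mulrN -mulNr mulN1r opprK mulrCA mulr_gt0 //.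
  by have := IH 0%N; rewrite /= addn0.
rewrite doubleS /= subn2 /=; have := IH j; have := IH j.+1.
rewrite doubleS ltnS addSn addnS !exprS !mulN1r opprK.
case: leqP => [jr|rj]; case: leqP => [jr2|rj2]; try lia.
- by move=> /eqP ->; rewrite mulr0 subr0.
- by move=> /eqP -> /eqP ->; rewrite mulr0 subr0.
- move=> H1 H2; rewrite mulrBr mulrCA addr_gt0 // -mulrN mulr_gt0 //.
  by rewrite -mulNr.
Qed.

(** * Taylor's formula with Peano remainder *)

Definition taylor_poly {R : realType} (n : nat) (f : R -> R) (x : R) : {poly R} :=
  \poly_(j < n.+1) (f^`(j)%classic x / j`!%:R).

Lemma deriv_taylor_poly (R : realType) n (f : R -> R) x :
  (taylor_poly n.+1 f x)^`() = taylor_poly n f^`()%classic x.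
Proof.
apply/polyP => i; rewrite coef_deriv !coef_poly ltnS; case: ltnP => [ilt|_]; last by rewrite mul0rn.
by rewrite derive1Sn factS natrM -[LHS]mulr_natr invfM mulrA mulrAC divfK ?pnatr_eq0.
Qed.

Lemma mean_value_bound (R : realType) (g dg : R -> R) (u e : R) :
  (forall v : R, `|v| <= `|u| -> is_derive (v : R) 1 g (dg v)) ->
  (forall v, `|v| <= `|u| -> `|dg v| <= e) ->
  `|g u - g 0| <= e * `|u|.
Proof.
move=> gd dge.
(* The mean value theorem wants ordered endpoints; this form serves [[0, u]] and [[u, 0]] alike. *)
have H (p q : R) : p <= q -> (forall v, v \in `[p, q] -> `|v| <= `|u|) ->
    `|g q - g p| <= e * `|q - p|.
  move=> pq pqu; have [||c cpq ->] := @MVT_segment R g dg p q pq.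
  - by move=> v /subset_itv_oo_cc vpq; apply: gd; exact: pqu.
  - apply: derivable_within_continuous => v vpq.
    exact: (@ex_derive _ _ _ _ _ _ _ (gd v (pqu _ vpq))).
  - by rewrite normrM ler_wpM2r // dge // pqu.
have [u0|u0] := leP 0 u.
  rewrite -{2}[u]subr0; apply: H => // v; rewrite in_itv /= => /andP[v0 vu].
  by rewrite !ger0_norm.
rewrite distrC -[in leRHS]normrN -[- u]sub0r; apply: H (ltW u0) _ => v.
rewrite in_itv /= => /andP[v0 vu].
by rewrite (ler0_norm (ltW u0)) ler0_norm // lerN2.
Qed.

(** Induction on [n]: the derivative of the remainder of [f] is the remainder of [f'] of one order
    less, and the mean value bound gives back the missing factor [|u|]. The base case is the
    definition of the derivative. *)
Lemma taylor_peano (R : realType) (n : nat) (f : R -> R) (x e : R) :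
  (forall j, (j <= n)%N -> \forall y \near x, derivable f^`(j)%classic y 1) ->
  0 < e ->
  \forall u \near (0 : R),
    `|f (x + u) - (taylor_poly n.+1 f x).[u]| <= e * `|u| ^+ n.+1.
Proof.
elim: n f e => [|n IH] f e df e0.
  have {}df : derivable f x 1 := nbhs_singleton (df 0%N isT).
  have /cvgrPdist_le /(_ e e0) := df.
  rewrite near_withinE; apply: filterS => u Hu.
  rewrite /taylor_poly horner_poly 2!big_ord_recl big_ord0 /= /bump /= !fact0.
  rewrite expr0 !expr1 !divr1 addr0 mulr1.
  (* The difference quotient says nothing at [u = 0], where both sides are 0. *)
  have [->|u0] := eqVneq u 0; first by rewrite !addr0 mulr0 addr0 subrr normr0 mulr0.
  have := Hu u0; rewrite -/('D_1 f x) -derive1E /= => /(ler_wpM2r (normr_ge0 u)).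
  rewrite -normrM distrC mulrBl -[_ *: _]/(_ * _) mulrAC mulVf // mul1r.
  have -> : u%:A = u := mulr1 u.
  by rewrite [u + x]addrC opprB addrA [_ + f x]addrC.
have dfn : \forall y \near x, derivable f y 1 by exact: (df 0%N).
have {}IH : \forall u \near (0 : R), `|f^`()%classic (x + u) -
    (taylor_poly n.+1 f^`()%classic x).[u]| <= e * `|u| ^+ n.+1.
  by apply: IH => // j jn; rewrite -derive1Sn; exact: df.
pose g u := f (x + u) - (taylor_poly n.+2 f x).[u].
pose dg u := f^`()%classic (x + u) - (taylor_poly n.+1 f^`()%classic x).[u].
have g0 : g 0 = 0.
  by rewrite /g addr0 horner_coef0 coef_poly /= fact0 divr1 subrr.
have : \forall v \near (0 : R), is_derive (v : R) 1 g (dg v) /\ `|dg v| <= e * `|v| ^+ n.+1.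
  near=> v; split; last by near: v.
  have dfv : derivable f (x + v) 1.
    near: v; have : (fun v => x + v) @ (0 : R) --> x.
      by rewrite -[X in _ --> X]addr0; apply: cvgD; [exact: cvg_cst|exact: cvg_id].
    by move=> /(_ _ dfn).
  have Df : is_derive (x + v) 1 f (f^`()%classic (x + v)).
    by rewrite derive1E; exact: derivableP.
  have Dfx : is_derive v 1 (f \o (fun w => x + w)) (f^`()%classic (x + v)).
    rewrite -[X in is_derive _ _ _ X]mulr1 -[X in _ * X]add0r.
    exact: is_derive1_comp.
  have Dp := is_derive_poly (taylor_poly n.+2 f x) v.
  by rewrite /g /dg -deriv_taylor_poly; exact: is_deriveB Dfx Dp.
(* A ball around 0 contains with [u] every [v] such that [|v| <= |u|], as the mean value bound
   requires. *)
move=> /nbhs_ballP[d /= d0 Hd]; apply/nbhs_ballP; exists d => // u.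
rewrite /ball /= sub0r normrN => ud.
have Hv (v : R) : `|v| <= `|u| -> is_derive v 1 g (dg v) /\ `|dg v| <= e * `|v| ^+ n.+1.
  by move=> vu; apply: Hd; rewrite /ball /= sub0r normrN (le_lt_trans vu).
have := @mean_value_bound R g dg u (e * `|u| ^+ n.+1) (fun v vu => (Hv v vu).1).
rewrite g0 subr0 -mulrA -exprSr; apply => v vu.
apply: le_trans (Hv v vu).2 _; rewrite ler_wpM2l ?(ltW e0) //.
by rewrite lerXn2r ?nnegrE.
Unshelve. all: by end_near.
Qed.

(** * Derivatives of polynomials and limits from the right at 0 *)

Lemma derive1n_horner (R : realType) (p : {poly R}) n :
  (horner p)^`(n)%classic = horner p^`(n).
Proof.
elim: n p => [|n IH] p; first by rewrite derivn0.
by rewrite derive1nS IH derivnS derivE.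
Qed.

Lemma near_all_seq (T : Type) (F : set_system T) (I : eqType) (s : seq I)
    (P : I -> T -> Prop) : Filter F ->
  (forall i, i \in s -> \forall t \near F, P i t) ->
  \forall t \near F, forall i, i \in s -> P i t.
Proof.
move=> FF; elim: s => [|i s IH] H; first exact: nearW.
have Hi : \forall t \near F, P i t by apply: H; rewrite inE eqxx.
have {}IH := IH (fun j js => H j (ltac:(by rewrite inE js orbT))).
near=> t; move=> j; rewrite inE => /orP[/eqP ->|]; first by near: t.
by move: j; near: t.
Unshelve. all: by end_near.
Qed.

(** The sign of [a] is free: [a * h] may approach 0 from either side or stay there, hence the
    two-sided neighborhood. *)
Lemma near0_scale (R : realType) (a : R) (P : set R) :
  (\forall u \near (0 : R), P u) -> \forall h \near 0^'+, P (a * h).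
Proof.
move=> HP; have : (fun h : R => a * h) @ 0^'+ --> (0 : R).
  rewrite -[X in _ --> X](mulr0 a); apply: cvgM; first exact: cvg_cst.
  exact: cvg_at_right_filter.
by move=> /(_ _ HP).
Qed.

(* Compare the limits along h and 2 h: they differ by the factor 2 `^ q. *)
Lemma powR_limit_nonzero (R : realType) (A B q : R) :
  (fun h => A * h `^ q) @ 0^'+ --> B -> B != 0 -> q = 0 /\ A = B.
Proof.
move=> AB B0.
have two : (fun h : R => A * (2 * h) `^ q) @ 0^'+ --> B.
  have : (fun h : R => 2 * h) @ 0^'+ --> 0^'+.
    move=> P; rewrite /at_right /nbhs /= => /near0_scale -/(_ 2) HP.
    have : \forall h \near (0:R)^'+, P (2 * h).
      near=> h; have : 0 < 2 * h -> P (2 * h) by near: h.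
      by apply; rewrite mulr_gt0.
    by [].
  by move=> D; exact: (cvg_comp _ _ D AB).
have q0 : q = 0.
  have : (2 `^ q) * B = B.
    have scaled : (fun h : R => A * (2 * h) `^ q) @ 0^'+ --> 2 `^ q * B.
      apply: cvg_trans (cvgM (cvg_cst (2 `^ q)) AB); apply: near_eq_cvg; near=> h.
      have h0 : 0 < h by [].
      by rewrite /= powRM ?(ltW h0) // mulrCA.
    exact: (norm_cvg_unique scaled two).
  move=> /eqP; rewrite -{2}[B]mul1r (inj_eq (mulIf B0)) => /eqP /(congr1 (@ln R)).
  rewrite ln_powR ln1 => /eqP; rewrite mulf_eq0 => /orP[/eqP //|].
  by rewrite ln_eq0 // => /eqP; lra.
split=> //; move: AB; rewrite q0; under eq_fun do rewrite powRr0 mulr1.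
move=> AB; exact: (norm_cvg_unique (cvg_cst A) AB).
Unshelve. all: by end_near.
Qed.

Lemma cvg_at_right_pow_bound (R : realType) (g : R -> R) (B C : R) (m : nat) :
  (0 < m)%N -> (\forall h \near 0^'+, `|g h - B| <= C * h ^+ m) ->
  g @ 0^'+ --> B.
Proof.
move=> m0 gB; have C0 : (fun h : R => C * h ^+ m) @ 0^'+ --> (0 : R).
  have : (fun h : R => C * h ^+ m) @ (0 : R)^'+ --> C * 0 ^+ m.
    apply: cvg_at_right_filter; apply: cvgM; first exact: cvg_cst.
    exact: exprn_continuous.
  by rewrite expr0n (gtn_eqF m0) mulr0.
apply/cvgrPdist_le => e e0; move/cvgrPdist_le: C0 => /(_ e e0) C0.
near=> h; rewrite distrC; have gh : `|g h - B| <= C * h ^+ m by near: h.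
apply: (le_trans gh); apply: le_trans (ler_norm _) _.
by rewrite -normrN -sub0r; near: h.
Unshelve. all: by end_near.
Qed.

Lemma derivn_comp_XsubC (R : comNzRingType) (q : {poly R}) (c : R) i :
  (q \Po ('X - c%:P))^`(i) = q^`(i) \Po ('X - c%:P).
Proof.
elim: i => [|i IH]; first by rewrite !derivn0.
by rewrite !derivnS IH deriv_comp derivXsubC mulr1.
Qed.

(** Test polynomials are written in powers of ['X - x], so that their derivatives at [x] are read
    off from their coefficients. *)
Lemma derive1n_horner_shift (R : realType) (q : {poly R}) (x : R) i :
  (horner (q \Po ('X - x%:P)))^`(i)%classic x = i`!%:R * q`_i.
Proof.
rewrite derive1n_horner derivn_comp_XsubC horner_comp !hornerE subrr.
by rewrite horner_coef0 coef_derivn addn0 ffactnn mulr_natl.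
Qed.

(** * Moment equations and accuracy order *)

(** Exchanging the sums brings out the moments, one for each Taylor term. *)
Lemma taylor_poly_weighted_sum (R : realType) (I : Type) (s : seq I) (a w : I -> R)
    n (f : R -> R) x h :
  \sum_(i <- s) w i * (taylor_poly n f x).[a i * h] =
  \sum_(j < n.+1) f^`(j)%classic x / j`!%:R * h ^+ j * \sum_(i <- s) w i * a i ^+ j.
Proof.
under [RHS]eq_bigr do rewrite mulr_sumr.
rewrite exchange_big /=; apply: eq_bigr => i _.
rewrite horner_poly mulr_sumr; apply: eq_bigr => j _.
by rewrite exprMn; ring.
Qed.

(** Among the Taylor terms of order at most [n], the moment equations leave only [f^(k)(x)]; order
    [n.+1] contributes [K * h ^+ (n.+1 - k)] with [K != 0], and the remainders are too small to
    cancel it. *)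
Lemma fd_accuracy (R : realType) (I : eqType) (s : seq I) (a w : I -> R)
    (k n : nat) (f : R -> R) (x : R) : (k <= n)%N ->
  (forall j, (j < n.+1)%N ->
     \sum_(i <- s) w i * a i ^+ j = k`!%:R * (j == k)%:R) ->
  \sum_(i <- s) w i * a i ^+ n.+1 != 0 ->
  (forall j, (j <= n)%N -> \forall y \near x, derivable f^`(j)%classic y 1) ->
  f^`(n.+1)%classic x != 0 ->
  (fun h : R => \sum_(i <- s) w i * h `^ (- k%:R) * f (x + a i * h)
                - f^`(k)%classic x)
    \is 'Theta_(0^'+) (fun h : R => h ^+ (n.+1 - k)).
Proof.
move=> kn wm; set S := \sum_(i <- s) _ => S0 df fn0.
pose T := taylor_poly n.+1 f x.
pose t : R := f^`(n.+1)%classic x / n.+1`!%:R; pose K := t * S.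
have K0 : K != 0.
  by rewrite !mulf_neq0 // invr_eq0 pnatr_eq0 -lt0n fact_gt0.
have K2 : 0 < `|K| / 2 by rewrite divr_gt0 ?normr_gt0.
have TE (h : R) : 0 < h -> \sum_(i <- s) w i * h `^ (- k%:R) * T.[a i * h] =
    f^`(k)%classic x + K * h ^+ (n.+1 - k).
  move=> h0; rewrite powR_invn ?(ltW h0) //.
  under eq_bigr do rewrite mulrAC.
  rewrite -mulr_suml taylor_poly_weighted_sum big_ord_recr /= -/S.
  rewrite (bigD1 (Ordinal (kn : (k < n.+1)%N))) //= wm // eqxx mulr1.
  rewrite big1 ?addr0 => [|j jk]; last first.
    by rewrite wm // (negbTE (jk : nat_of_ord j != k)) !mulr0.
  have hk0 : h ^+ k != 0 by rewrite expf_neq0 ?gt_eqF.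
  rewrite mulrDl; congr (_ + _).
    by field; rewrite hk0 pnatr_eq0 -lt0n fact_gt0.
  have -> : h ^+ n.+1 = h ^+ (n.+1 - k) * h ^+ k by rewrite -exprD subnK // leqW.
  rewrite /K; move: (h ^+ k) hk0 (h ^+ (_ - _)) => y y0 z.
  by rewrite -/t; field.
pose A := \sum_(i <- s) `|w i| * `|a i| ^+ n.+1.
have A0 : 0 <= A by apply: sumr_ge0 => i _; rewrite mulr_ge0 ?exprn_ge0.
(* With this [e] the weighted remainders add up to at most half of the main term; [1 + A] keeps the
   denominator positive. *)
pose e := `|K| / 2 / (1 + A).
have e0 : 0 < e by rewrite divr_gt0 // ltr_wpDr.
have eA : e * A <= `|K| / 2.
  by rewrite /e mulrAC ler_pdivrMr ?ltr_wpDr // ler_wpM2l ?(ltW K2) // lerDr.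
have := taylor_peano df e0; rewrite -/T => HT.
have {}HT : \forall h \near 0^'+, forall i, i \in s ->
    `|f (x + a i * h) - T.[a i * h]| <= e * `|a i * h| ^+ n.+1.
  by apply: near_all_seq => i _; exact: (near0_scale (a i) HT).
(* An error within [|K| / 2] of [K], after division by [h ^+ (n.+1 - k)], lies between [|K| / 2] and
   [3 |K| / 2] in absolute value. *)
apply/asboolP; exists (`|K| / 2, `|K| / 2 + `|K|) => /=.
  by rewrite K2 addr_gt0 ?normr_gt0.
near=> h.
have h0 : 0 < h by [].
have Hh : forall i, i \in s -> `|f (x + a i * h) - T.[a i * h]| <= e * `|a i * h| ^+ n.+1.
  by near: h.
set E := (_ - _); set hm := h ^+ (n.+1 - k).
have hm0 : 0 < hm by rewrite exprn_gt0.
have Eb : `|E - K * hm| <= `|K| / 2 * hm.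
  have -> : E - K * hm = \sum_(i <- s) w i * h `^ (- k%:R) * (f (x + a i * h) - T.[a i * h]).
    under [RHS]eq_bigr do rewrite mulrBr.
    by rewrite sumrB TE // /E opprD addrA.
  apply: le_trans (ler_norm_sum _ _ _) _.
  apply: (@le_trans _ _ (\sum_(i <- s) e * (`|w i| * `|a i| ^+ n.+1) * hm)); last first.
    by rewrite -mulr_suml -mulr_sumr (ler_wpM2r (ltW hm0)).
  rewrite big_seq [leRHS]big_seq; apply: ler_sum => i si.
  rewrite !normrM (ger0_norm (powR_ge0 _ _)) powR_invn ?(ltW h0) //.
  have wh0 : 0 <= `|w i| * h ^- k by rewrite mulr_ge0 // invr_ge0 exprn_ge0 // ltW.
  apply: (le_trans (ler_wpM2l wh0 (Hh i si))).
  have hN : h ^+ n.+1 = hm * h ^+ k by rewrite -exprD subnK // leqW.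
  rewrite normrM (gtr0_norm h0) exprMn hN.
  have hk0 : h ^+ k != 0 by rewrite expf_neq0 ?gt_eqF.
  by rewrite le_eqVlt; apply/orP; left; apply/eqP; field.
rewrite (gtr0_norm hm0).
have Khm : `|K * hm| = `|K| * hm by rewrite normrM (gtr0_norm hm0).
have := ler_distD 0 E (K * hm); have := ler_distD 0 (K * hm) E.
have := lerB_dist (K * hm) E; have := lerB_dist E (K * hm).
rewrite !subr0 !sub0r !normrN [`|K * hm - E|]distrC Khm => h1 h2 _ _; split; nra.
Unshelve. all: by end_near.
Qed.

(* Test polynomials q must have q`_N != 0, so the error for 'X^j, j < N, is
   bounded as the difference of the errors for 'X^N + 'X^j and 'X^N. *)
Lemma fd_moments (R : realType) (I : eqType) (s : seq I) (a w : I -> R)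
    (k N : nat) (p x : R) : (k < N)%N ->
  (forall q : {poly R}, q`_N != 0 ->
     (fun h : R => \sum_(i <- s) w i * h `^ p * (q \Po ('X - x%:P)).[x + a i * h]
                   - (horner (q \Po ('X - x%:P)))^`(k)%classic x)
       \is 'Theta_(0^'+) (fun h : R => h ^+ (N - k))) ->
  p = - k%:R /\
  forall j, (j < N)%N -> \sum_(i <- s) w i * a i ^+ j = k`!%:R * (j == k)%:R.
Proof.
move=> kN acc.
pose S j := \sum_(i <- s) w i * a i ^+ j.
pose err (q : {poly R}) (h : R) := \sum_(i <- s) w i * h `^ p * q.[a i * h] - k`!%:R * q`_k.
have errO (q : {poly R}) : q`_N != 0 ->
    exists C, \forall h \near 0^'+, `|err q h| <= C * h ^+ (N - k).
  move=> /acc; rewrite qualifE => /asboolP[[c C] /= _ HC]; exists C.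
  near=> h; have h0 : 0 < h by [].
  have : `|\sum_(i <- s) w i * h `^ p * (q \Po ('X - x%:P)).[x + a i * h]
           - (horner (q \Po ('X - x%:P)))^`(k)%classic x| <= C * `|h ^+ (N - k)|.
    by near: h; apply: filterS HC => ? [].
  rewrite derive1n_horner_shift [`|h ^+ _|]ger0_norm ?exprn_ge0 ?(ltW h0) //.
  rewrite (_ : \sum_(i <- s) _ = \sum_(i <- s) w i * h `^ p * q.[a i * h]) //.
  apply: eq_bigr => i _.
  by rewrite horner_comp hornerXsubC addrAC subrr add0r.
have key j : (j < N)%N -> exists C, \forall h \near 0^'+,
    `|S j * h `^ (p + j%:R) - k`!%:R * (j == k)%:R| <= C * h ^+ (N - k).
  move=> jN; have [|C1 H1] := errO ('X^N + 'X^j).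
    by rewrite coefD !coefXn eqxx (gtn_eqF jN) addr0 oner_neq0.
  have [|C0 H0] := errO 'X^N; first by rewrite coefXn eqxx oner_neq0.
  exists (C1 + C0); near=> h; have h0 : 0 < h by [].
  have -> : S j * h `^ (p + j%:R) - k`!%:R * (j == k)%:R =
      err ('X^N + 'X^j) h - err 'X^N h.
    transitivity (err 'X^j h).
      rewrite /err coefXn [k == j]eq_sym; congr (_ - _).
      rewrite mulr_suml; apply: eq_bigr => i _; rewrite hornerXn exprMn.
      by rewrite powRD ?(gt_eqF h0) ?implybT // powR_mulrn ?(ltW h0) //; ring.
    have -> : err ('X^N + 'X^j) h = err 'X^N h + err 'X^j h.
      rewrite /err coefD mulrDr opprD addrACA -big_split; congr (_ + _).
      by apply: eq_bigr => i _; rewrite hornerD mulrDr.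
    by rewrite addrC addKr.
  apply: le_trans (ler_normB _ _) _; rewrite mulrDl lerD //; by near: h.
have Nk : (0 < N - k)%N by rewrite subn_gt0.
(* For [j = k] the function [S k * h ^ (p + k)] tends to the nonzero limit [k!], which forces
   [p + k = 0] and [S k = k!]. *)
have [C HC] := key k kN.
rewrite eqxx mulr1 in HC.
have := powR_limit_nonzero (cvg_at_right_pow_bound Nk HC).
rewrite pnatr_eq0 -lt0n fact_gt0 => /(_ isT)[pk Sk].
have {}pk : p = - k%:R by apply/eqP; rewrite -addr_eq0 pk.
split=> // j jN; have [->|jk] := eqVneq j k; first by rewrite mulr1.
(* With [p = - k] the bound becomes [|S j| <= D * h ^+ (N - j)], so the constant [S j] has limit
   0. *)
have [D HD] := key j jN.
rewrite mulr0; rewrite (negPf jk) mulr0 in HD.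
apply: (norm_cvg_unique (F := (fun=> S j) @ (0 : R)^'+)); first exact: cvg_cst.
have Nj : (0 < N - j)%N by rewrite subn_gt0.
apply: (@cvg_at_right_pow_bound _ _ _ D _ Nj); near=> h.
have h0 : 0 < h by [].
have : `|S j * h `^ (p + j%:R) - 0| <= D * h ^+ (N - k) by near: h.
rewrite !subr0 pk powRD ?(gt_eqF h0) ?implybT // powR_invn ?(ltW h0) // powR_mulrn ?(ltW h0) //.
have hj : 0 < h ^+ j by rewrite exprn_gt0.
have hk : 0 < h ^+ k by rewrite exprn_gt0.
rewrite mulrA normrM (gtr0_norm hj) normrM normfV (gtr0_norm hk).
rewrite -(ler_pM2r hk) mulrAC divfK ?gt_eqF // -mulrA -exprD subnK 1?ltnW //.
by move=> Sj; rewrite -(ler_pM2r hj) -mulrA -exprD subnK 1?ltnW.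
Unshelve. all: by end_near.
Qed.

(** * The stencil as a list of indices *)

Definition opposite_pairs (M : nat) : seq int :=
  [seq - n%:Z | n <- iota 1 M] ++ [seq n%:Z | n <- iota 1 M].

(** The order of the list is immaterial for sums; keeping 0 in front of the opposite pairs lets the
    node polynomial split off its factor ['X]. *)
Definition stencil_seq (N : nat) : seq int :=
  if odd N then 0 :: opposite_pairs N./2 else opposite_pairs N./2.

Lemma mem_opposite_pairs M (n : int) :
  (n \in opposite_pairs M) = (`|n| <= M%:Z) && (n != 0).
Proof.
rewrite mem_cat; apply/idP/idP => [/orP[] /mapP[i + ->]|/andP[nM n0]].
- by rewrite mem_iota; lia.
- by rewrite mem_iota; lia.
case: n nM n0 => n nM n0; apply/orP; [right|left]; apply/mapP.
  by exists n => //; rewrite mem_iota; lia.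
by exists n.+1; [rewrite mem_iota; lia|rewrite NegzE].
Qed.

Lemma mem_stencil_seq N : stencil_seq N =i stencil_index N.
Proof.
move=> n; rewrite /stencil_seq /stencil_index !inE; case: ifP => oN /=.
  rewrite inE mem_opposite_pairs andbT; have [->|//] := eqVneq n 0.
  by rewrite normr0.
  by rewrite andbT.
by rewrite mem_opposite_pairs.
Qed.

Lemma uniq_stencil_seq N : uniq (stencil_seq N).
Proof.
have up M : uniq (opposite_pairs M).
  rewrite cat_uniq !map_inj_uniq ?iota_uniq //; last 2 first.
  - by move=> m n [].
  - by move=> m n /oppr_inj [].
  rewrite andbT; apply/hasPn => _ /mapP[i + ->]; rewrite mem_iota => i1.
  by apply/mapP => -[j]; rewrite mem_iota; lia.
by rewrite /stencil_seq; case: ifP => //= _; rewrite up mem_opposite_pairs eqxx andbF.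
Qed.

Lemma size_stencil_seq N : size (stencil_seq N) = N.
Proof.
rewrite /stencil_seq /opposite_pairs; case: ifP => oN /=.
all: by rewrite size_cat !size_map !size_iota; have := odd_double_half N; lia.
Qed.

Lemma finite_differenceE (R : realType) N (an c : int -> R) f (x h : R) :
  finite_difference N an c f x h =
  \sum_(n <- stencil_seq N) c n * f (x + an n * h).
Proof.
rewrite /finite_difference; case: ifP => oN; last first.
  by rewrite big_split /stencil_seq oN big_cat !big_map /index_iota subn1.
rewrite -(big_map (fun i : nat => i%:Z - N./2%:Z) xpredT (fun n => c n * f (x + an n * h))).
apply: perm_big; apply: uniq_perm; rewrite ?uniq_stencil_seq //.
  by rewrite map_inj_uniq ?iota_uniq // => m n /addIr [].
move=> n; rewrite mem_stencil_seq; apply/mapP/idP.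
  by move=> [i]; rewrite mem_index_iota => iM ->; rewrite inE oN /=; lia.
(* The shifted index [n + M] is nonnegative, so [absz] does not alter it. *)
rewrite inE oN andbT => nM; exists (absz (n + N./2%:Z)); first by rewrite mem_index_iota; lia.
by lia.
Qed.

Lemma stencil_injective (R : realType) N (an : int -> R) :
  fundamental_stencil N an -> {in stencil_seq N &, injective an}.
Proof.
move=> inc m n; rewrite !mem_stencil_seq => ms ns mn.
have [lt|lt|//] := ltgtP m n.
  by have := inc _ _ ms ns lt; rewrite mn ltxx.
by have := inc _ _ ns ms lt; rewrite mn ltxx.
Qed.

(** * Consequences of centering: symmetry and a nonzero leading moment *)

Lemma centered_opp (R : realType) N (an : int -> R) n :
  centered N an -> n \in stencil_seq N -> an (- n) = - an n.
Proof.
move=> [anN an0]; rewrite mem_stencil_seq inE => /andP[nM].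
case: n nM => [[|n]|n] nM; rewrite ?orbT ?eqxx ?orbF.
- by move=> /an0 ->; rewrite oppr0.
- by move=> _; apply: anN; lia.
- by move=> _; rewrite NegzE opprK anN ?opprK //; lia.
Qed.

Lemma centered_pos (R : realType) N (an : int -> R) (n : nat) :
  fundamental_stencil N an -> centered N an -> (1 <= n <= N./2)%N -> 0 < an n.
Proof.
move=> inc [anN _] nM; have := inc (- n%:Z) n.
rewrite !inE anN // => H; suff : - an n < an n by lra.
by apply: H; lia.
Qed.

Lemma opp_stencil_perm N : perm_eq (map -%R (stencil_seq N)) (stencil_seq N).
Proof.
have oppI : injective (-%R : int -> int) := oppr_inj.
apply: uniq_perm; rewrite ?(map_inj_uniq oppI) ?uniq_stencil_seq // => n.
rewrite -[n in LHS]opprK (mem_map oppI) !mem_stencil_seq !inE.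
by rewrite normrN oppr_eq0.
Qed.

(** Reflection multiplies the [j]-th moment by [(-1)^j]. Only the moment [j = k] is nonzero, and
    there the factor [(-1)^k] compensates, so the reflected weights solve the same equations and
    uniqueness applies. *)
Lemma fd_weight_opp (R : realType) N k (an : int -> R) n :
  fundamental_stencil N an -> centered N an -> n \in stencil_seq N ->
  (-1) ^+ k * fd_weight (stencil_seq N) an k (- n) = fd_weight (stencil_seq N) an k n.
Proof.
move=> inc cen; move: n; set s := stencil_seq N; set w := fd_weight s an k.
have us : uniq s by exact: uniq_stencil_seq.
have ainj : {in s &, injective an} by exact: stencil_injective.
apply: (fd_weight_unique us ainj) => j js.
rewrite -(perm_big _ (opp_stencil_perm N)) big_map /= -/s.
transitivity ((-1) ^+ k * (-1) ^+ j * \sum_(n <- s) w n * an n ^+ j).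
  rewrite mulr_sumr big_seq [RHS]big_seq; apply: eq_bigr => n ns.
  by rewrite opprK (centered_opp cen ns) [(- an n) ^+ j]exprNn; ring.
rewrite fd_weight_moment //; have [->|_] := eqVneq j k; last by rewrite !mulr0.
by rewrite -exprMn mulrNN mulr1 expr1n mul1r.
Qed.

Lemma fd_weight_leading_neq0 (R : realType) N k (an : int -> R) :
  fundamental_stencil N an -> centered N an -> odd k = odd N -> (k < N)%N ->
  \sum_(n <- stencil_seq N) fd_weight (stencil_seq N) an k n * an n ^+ N != 0.
Proof.
move=> inc cen kN kltN; have := @fd_weight_leading_moment R int (stencil_seq N) an k (uniq_stencil_seq N).
rewrite size_stencil_seq => -> //; last exact: stencil_injective.
rewrite oppr_eq0 mulf_neq0 ?pnatr_eq0 -?lt0n ?fact_gt0 //.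
(* The nodes [an n] and [- an n] combine into one factor in ['X^2]. *)
have pairs : \prod_(n <- opposite_pairs N./2) ('X - (an n)%:P) =
    \prod_(n <- iota 1 N./2) ('X^2 - (an n%:Z ^+ 2)%:P).
  rewrite big_cat !big_map /= -big_split big_seq [RHS]big_seq /=.
  apply: eq_bigr => n; rewrite mem_iota => nM.
  by rewrite cen.1 ?polyCN ?rmorphXn /=; [ring|lia].
have sgn := @prod_X2subC_sign R nat (iota 1 N./2) (fun n => an n%:Z ^+ 2) k./2.
have {sgn} : (\prod_(n <- iota 1 N./2) ('X^2 - (an n%:Z ^+ 2)%:P))`_k./2.*2 != 0.
  move: sgn; rewrite size_iota half_leq ?(ltnW kltN) // => sgn.
  have := @lt0r_neq0 R _ (sgn _); rewrite mulf_eq0 negb_or => H.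
  suff /H/andP[] : {in iota 1 N./2, forall n, 0 < an n%:Z ^+ 2} by [].
  move=> n; rewrite mem_iota => nM; rewrite exprn_gt0 //.
  by apply: (centered_pos inc cen); lia.
(* For odd [N] the node 0 contributes a factor ['X], which shifts degrees by one; as [k] has the
   parity of [N], both cases reach the even degree [k./2.*2] of the paired product. *)
have := odd_double_half k; move: k./2 => j; rewrite /stencil_seq -kN.
case: ifP => ok /= kE cj; rewrite -kE; last by rewrite pairs.
by rewrite big_cons pairs cen.2 -?kN // subr0 coefXM.
Qed.

(** * Existence, uniqueness and symmetry of the coefficients *)

Theorem theorem2p8 (R : realType) (a b x : R) (k N : nat) (an : int -> R)
    (hx : x \in `]a, b[) (hk : (0 < k)%N) (hN : (0 < N)%N)
    (hparity : odd k = odd N) (hkN : (k + 1 <= N)%N)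
    (hstencil : fundamental_stencil N an) (hcentered : centered N an) :
  exists c : R -> int -> R,
    [/\ power_law N c /\ accuracy_order N k (N - k) a b x an c,
        forall c' : R -> int -> R,
          power_law N c' -> accuracy_order N k (N - k) a b x an c' ->
          forall (h : R) (n : int), 0 < h -> n \in stencil_index N ->
            c' h n = c h n,
        ~~ odd k -> forall h : R, 0 < h -> symmetric_coeffs N (c h)
      & odd k -> forall h : R, 0 < h -> skew_symmetric_coeffs N (c h)].
Proof.
have kN : (k < N)%N by rewrite -addn1.
pose s := stencil_seq N; pose w := fd_weight s an k.
have us : uniq s := uniq_stencil_seq N.
have ainj : {in s &, injective an} := stencil_injective hstencil.
have sizes : size s = N := size_stencil_seq N.
have wopp n : n \in s -> (-1) ^+ k * w (- n) = w n by exact: fd_weight_opp.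
have index_s (n : nat) : (1 <= n <= N./2)%N -> n%:Z \in s.
  by move=> nM; rewrite mem_stencil_seq !inE; lia.
exists (fun h n => w n * h `^ (- k%:R)); split; [split| | |].
- by exists (- k%:R), w.
- move=> f df fN0.
  under eq_fun do rewrite finite_differenceE.
  (* The order of the first nonvanishing error term is a successor in [fd_accuracy], hence
     [N.-1]. *)
  have := @fd_accuracy R int s an w k N.-1 f x; rewrite prednK //; apply => //.
  + by rewrite -ltnS prednK.
  + by move=> j jN; apply: fd_weight_moment; rewrite ?sizes.
  + exact: fd_weight_leading_neq0.
  + move=> j jN; near=> y; apply: df; first by rewrite -[N]prednK.
    by near: y; exact: near_in_itvoo.
- move=> c' [p [g cE]] acc h n h0 ns.
  have [pk gm] : p = - k%:R /\ forall j, (j < N)%N ->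
      \sum_(i <- s) g i * an i ^+ j = k`!%:R * (j == k)%:R.
    apply: (fd_moments (x := x) kN) => q qN.
    have : (fun h : R => finite_difference N an (c' h) (horner (q \Po ('X - x%:P))) x h
        - (horner (q \Po ('X - x%:P)))^`(k)%classic x)
        \is 'Theta_(0^'+) (fun h : R => h ^+ (N - k)).
      apply: acc; last first.
        by rewrite derive1n_horner_shift mulf_neq0 // pnatr_eq0 -lt0n fact_gt0.
      by move=> j _ y _; rewrite derive1n_horner; exact: derivable_horner.
    rewrite qualifE => /asboolP[C C0 HC]; apply/asboolP; exists C => //.
    (* The two error functions agree for positive steps, where the power law holds, and this
       suffices for a bound along [0^'+]. *)
    near=> t; have t0 : 0 < t by [].
    rewrite (_ : \sum_(i <- s) _ = finite_difference N an (c' t) (horner (q \Po ('X - x%:P))) x t).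
      by near: t.
    rewrite finite_differenceE big_seq [RHS]big_seq; apply: eq_bigr => i si.
    by rewrite cE // -mem_stencil_seq.
  rewrite cE // pk; congr (_ * _); apply: (fd_weight_unique us ainj).
    by move=> j; rewrite sizes; exact: gm.
  by rewrite mem_stencil_seq.
- move=> ek h h0 n nM; congr (_ * _).
  by rewrite -[RHS]wopp ?index_s // -signr_odd (negbTE ek) mul1r.
- move=> ok h h0 n nM.
  by rewrite -[w n%:Z]wopp ?index_s // -signr_odd ok mulN1r mulNr opprK.
Unshelve. all: by end_near.
Qed.
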